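(* Let $\mathbf F$ be a finite field. Generic finite-dimensional algebras over $\mathbf F$ are cyclic and contain no proper subalgebras of dimension greater than $1$. That is, if $\varphi(m)$ is the number of pairwise nonisomorphic $m$-dimensional algebras over $\mathbf F$ and $\varphi_{\mathcal P}(m)$ is the number of those of them which can be generated by one element and have no proper subalgebra of dimension greater than $1$, then $$\lim_{m\to\infty}\frac{\varphi_{\mathcal P}(m)}{\varphi(m)}=1.$$
   Context: An algebra over a field $\mathbf F$ is a vector space over $\mathbf F$ with an arbitrary bilinear multiplication (not assumed associative, commutative or unital). Algebras are counted up to isomorphism. An algebra is cyclic if it is generated (as an algebra) by one element. *)

(* Defs.v *)
From HB Require Import structures.
From mathcomp Require Import all_boot all_order all_algebra.
From mathcomp Require Import boolp.

Set Implicit Arguments.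
Unset Strict Implicit.
Unset Printing Implicit Defensive.

Import GRing.Theory VectorInternalTheory.
Local Open Scope ring_scope.

Section Algebra.
Variables (F : fieldType) (V : vectType F).

(* An algebra on V is a multiplication V -> V -> V satisfying is_algebra. *)
Definition is_algebra (mul : V -> V -> V) : Prop :=
  bilinear_for *:%R *:%R mul.

(* Subalgebras need not contain a unit; in particular 0 is a subalgebra. *)
Definition subalgebra (mul : V -> V -> V) (U : {vspace V}) : Prop :=
  forall x y, x \in U -> y \in U -> mul x y \in U.

(* The subalgebra generated by a, as the intersection of all subalgebras
   containing a. *)
Definition generated (mul : V -> V -> V) (a x : V) : Prop :=
  forall U : {vspace V}, subalgebra mul U -> a \in U -> x \in U.

Definition cyclic_algebra (mul : V -> V -> V) : Prop :=
  exists a, forall x, generated mul a x.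

Definition no_proper_subalgebra_dim_gt1 (mul : V -> V -> V) : Prop :=
  forall U : {vspace V},
    subalgebra mul U -> U != fullv -> ~~ (1 < \dim U)%N.

End Algebra.

Definition algebra_iso (F : fieldType) (V W : vectType F)
    (mulV : V -> V -> V) (mulW : W -> W -> W) : Prop :=
  exists f : {linear V -> W},
    bijective f /\ forall x y, f (mulV x y) = mulW (f x) (f y).

Section Counting.
Variables (F : finFieldType) (m : nat).

Definition mul_table :=
  {ffun 'rV[F]_m -> {ffun 'rV[F]_m -> 'rV[F]_m}}.

Definition table_mul (A : mul_table) : 'rV[F]_m -> 'rV[F]_m -> 'rV[F]_m :=
  fun x y => A x y.

(* Algebras with carrier F^m; by algebra_iso_table every m-dimensional algebra
   over F is isomorphic to one of them. *)
Definition algebras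
    (P : ('rV[F]_m -> 'rV[F]_m -> 'rV[F]_m) -> Prop) : {set mul_table} :=
  [set A | `[< is_algebra (table_mul A) /\ P (table_mul A) >]].

Definition num_iso_classes
    (P : ('rV[F]_m -> 'rV[F]_m -> 'rV[F]_m) -> Prop) : nat :=
  #|equivalence_partition
      (fun A B => `[< algebra_iso (table_mul A) (table_mul B) >])
      (algebras P)|.

Definition phi : nat := num_iso_classes (fun=> True).

Definition phiP : nat :=
  num_iso_classes
    (fun mul => cyclic_algebra mul /\ no_proper_subalgebra_dim_gt1 mul).

End Counting.

Lemma algebra_iso_refl (F : fieldType) (V : vectType F) (mul : V -> V -> V) :
  algebra_iso mul mul.
Proof. by exists idfun; split=> //; exists id. Qed.

Lemma algebra_iso_sym (F : fieldType) (V W : vectType F)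
    (mulV : V -> V -> V) (mulW : W -> W -> W) :
  algebra_iso mulV mulW -> algebra_iso mulW mulV.
Proof.
case=> f [[g fK gK] fM].
have g_lin : linear g by move=> a x y; apply: (can_inj fK); rewrite linearP !gK.
pose mg := GRing.isLinear.Build F W V *:%R g g_lin.
pose G : {linear W -> V} := HB.pack g mg.
exists G; split=> [|x y]; first by exists f.
by apply: (can_inj fK); rewrite /= fM !gK.
Qed.

Lemma algebra_iso_trans (F : fieldType) (U V W : vectType F)
    (mulU : U -> U -> U) (mulV : V -> V -> V) (mulW : W -> W -> W) :
  algebra_iso mulU mulV -> algebra_iso mulV mulW -> algebra_iso mulU mulW.
Proof.
case=> f [f_bij fM] [g [g_bij gM]]; exists (g \o f : {linear U -> W}).
by split=> [|x y]; [exact: bij_comp | rewrite /= fM gM].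
Qed.

Lemma algebra_iso_table (F : finFieldType) (V : vectType F)
    (mul : V -> V -> V) : is_algebra mul ->
  exists2 A, A \in algebras (F := F) (m := dim V) (fun=> True)
           & algebra_iso mul (table_mul A).
Proof.
move=> [mulL mulR].
pose A : mul_table F (dim V) := [ffun x => [ffun y => v2r (mul (r2v x) (r2v y))]].
have AE x y : table_mul A x y = v2r (mul (r2v x) (r2v y)).
  by rewrite /table_mul !ffunE.
exists A.
  rewrite inE; apply/asboolP; split=> //; split=> u a x y; rewrite !AE linearP.
    by rewrite mulL linearP.
  by rewrite mulR linearP.
exists (v2r : {linear V -> _}); split=> [|x y]; last by rewrite AE !v2rK.
by exists r2v; [exact: v2rK | exact: r2vK].
Qed.

(* Main.v *)
(** Let q = |F|. The group GL_m acts on the q^(m^3) multiplication tables on F^m,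
    and isomorphism classes are orbits, so Burnside's formula gives
    phi(m) |GL_m| = sum_g |Fix g|. If g is scalar, g <> 1, it fixes only the zero
    multiplication. Otherwise some x and xg are independent; complete them to a
    basis. In a g-invariant algebra, multiplication by xg (on either side) is
    determined by multiplication by x, which leaves at most (m-1)^2+2 products of
    basis vectors to choose. Hence sum_(g <> 1) |Fix g| <= q^(m^2 + m((m-1)^2+2)),
    which is negligible against q^(m^3), and it suffices to bound the tables which
    are not generic.

    A subspace of dimension d is a subalgebra for a fraction at most
    q^(-d^2(m-d)) of the tables. There are at most q^(dm) such subspaces, and at
    most q^m hyperplanes, so proper subalgebras of dimension d > 1 are rare: use
    the first bound for d <= m-2, the second for d = m-1. If there are none, any
    line which is not a subalgebra generates everything, and one fixed line is a
    subalgebra only with probability q^(1-m). *)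
From HB Require Import structures.
Require Import Defs.
From mathcomp Require Import all_boot all_order all_algebra all_fingroup finfield zify.
From mathcomp Require Import boolp.

Set Implicit Arguments.
Unset Strict Implicit.
Unset Printing Implicit Defensive.

Import GRing.Theory.
Local Open Scope ring_scope.

(** * Counting multiplication tables through products of basis vectors *)

Section Tables.
Variables (F : finFieldType) (m : nat).
Local Notation V := 'rV[F]_m.
Local Notation q := #|F|.
Implicit Types (A : mul_table F m) (P : (V -> V -> V) -> Prop).

Lemma in_algebras P A :
  A \in algebras P <-> is_algebra (table_mul A) /\ P (table_mul A).
Proof. by rewrite inE; split=> [/asboolP|?]; [| apply/asboolP]. Qed.

Lemma table_eqP A A' :
  (forall x y, table_mul A x y = table_mul A' x y) -> A = A'.
Proof. by move=> eqA; apply/ffunP=> x; apply/ffunP=> y; apply: eqA. Qed.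

Lemma mul_sumr (mul : V -> V -> V) (I : finType) x (c : I -> F) (e : I -> V) :
  is_algebra mul ->
  mul x (\sum_i c i *: e i) = \sum_i c i *: mul x (e i).
Proof.
case=> _ mulR; pose h := GRing.isLinear.Build _ _ _ _ _ (mulR x).
pose f : {linear V -> V} := HB.pack (mul x) h.
rewrite -[mul x]/(f : V -> V) linear_sum.
by apply: eq_bigr => i _; rewrite linearZ.
Qed.

Lemma mul_suml (mul : V -> V -> V) (I : finType) y (c : I -> F) (e : I -> V) :
  is_algebra mul ->
  mul (\sum_i c i *: e i) y = \sum_i c i *: mul (e i) y.
Proof.
case=> mulL _; pose h := GRing.isLinear.Build _ _ _ _ _ (mulL y).
pose f : {linear V -> V} := HB.pack (mul ^~ y) h.
rewrite -[LHS]/(f _) linear_sum.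
by apply: eq_bigr => i _; rewrite linearZ.
Qed.

Lemma eq_mulr_basis (mul mul' : V -> V -> V) (b : m.-tuple V) x x' :
  is_algebra mul -> is_algebra mul' -> basis_of fullv b ->
  (forall j : 'I_m, mul x b`_j = mul' x' b`_j) -> forall y, mul x y = mul' x' y.
Proof.
move=> Hm Hm' bb eqx y; rewrite (coord_basis bb (memvf y)) !mul_sumr //.
by apply: eq_bigr => i _; rewrite eqx.
Qed.

Lemma eq_mull_basis (mul mul' : V -> V -> V) (b : m.-tuple V) y y' :
  is_algebra mul -> is_algebra mul' -> basis_of fullv b ->
  (forall i : 'I_m, mul b`_i y = mul' b`_i y') -> forall x, mul x y = mul' x y'.
Proof.
move=> Hm Hm' bb eqy x; rewrite (coord_basis bb (memvf x)) !mul_suml //.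
by apply: eq_bigr => i _; rewrite eqy.
Qed.

Lemma dim_rV : \dim {:V} = m.
Proof. by rewrite dimvf dim_matrix mul1r. Qed.

(** Keeping [X] as a prefix lets later counts address the prescribed vectors by index. *)
Lemma free_complete (X : seq V) : free X ->
  exists b : m.-tuple V, basis_of fullv b /\
    forall i, (i < size X)%N -> b`_i = X`_i.
Proof.
move=> freeX; pose b := X ++ vbasis (<<X>>^C)%VS.
have bb : basis_of fullv b.
  rewrite -(addv_complf <<X>>%VS); apply: cat_basis; last exact: vbasisP.
    by apply/directv_addP; apply: capv_compl.
  by rewrite /basis_of eqxx.
have size_b : size b == m.
  have := bb; rewrite basisEfree => /and3P[/eqnP <- _ _].
  by rewrite (span_basis bb) dim_rV.
exists (Tuple size_b); split=> // i ltiX.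
by rewrite /= nth_cat ltiX.
Qed.

(** The common counting device: by bilinearity a table is determined by its products of basis
    vectors, and the last hypothesis reduces these to the positions in [K], so [X] injects into the
    choices allowed by [S]. *)
Lemma card_algebras_le (b : m.-tuple V) (X : {set mul_table F m})
    (K : {set 'I_m * 'I_m}) (S : 'I_m * 'I_m -> {set V}) :
    basis_of fullv b -> X \subset algebras (fun=> True) ->
    (forall A p, A \in X -> p \in K -> table_mul A b`_p.1 b`_p.2 \in S p) ->
    (forall A A', A \in X -> A' \in X ->
      (forall i j, (i, j) \in K ->
         table_mul A b`_i b`_j = table_mul A' b`_i b`_j) ->
      forall i j : 'I_m, table_mul A b`_i b`_j = table_mul A' b`_i b`_j) ->
  (#|X| <= \prod_(p in K) #|S p|)%N.
Proof.
move=> bb sXalg XS Xinj.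
(* The default 0 off [K] places [t A] in a [pfamily], whose cardinality is the required product. *)
pose t A : {ffun 'I_m * 'I_m -> V} :=
  [ffun p => if p \in K then table_mul A b`_p.1 b`_p.2 else 0].
have t_inj : {in X &, injective t}.
  move=> A A' AX A'X /ffunP eqt; apply: table_eqP => x y.
  have [algA _] := (in_algebras _ A).1 (subsetP sXalg _ AX).
  have [algA' _] := (in_algebras _ A').1 (subsetP sXalg _ A'X).
  apply: (eq_mulr_basis algA algA' bb) => j.
  apply: (eq_mull_basis algA algA' bb) => i.
  by apply: Xinj => // {}i {}j ijK; have := eqt (i, j); rewrite !ffunE ijK.
rewrite -(card_in_imset t_inj).
have -> : \prod_(p in K) #|S p| = #|pfamily (0 : V) K (fun p => mem (S p))|.
  by rewrite card_pfamily foldrE big_image.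
apply/subset_leq_card/subsetP => _ /imsetP[A AX ->].
apply/pfamilyP; split=> [|p pK]; last by rewrite ffunE pK XS.
apply/subsetP=> p; rewrite inE ffunE; case: ifP => //.
by rewrite eqxx.
Qed.

(** Products of standard basis vectors can be prescribed freely: distinct choices [c] extend
    bilinearly to distinct tables. *)
Lemma card_algebras_ge : (q ^ (m * m ^ 2) <= #|algebras (F := F) (m := m) (fun=> True)|)%N.
Proof.
pose t (c : {ffun 'I_m * 'I_m -> V}) : mul_table F m :=
  [ffun x : V => ([ffun y : V => \sum_i \sum_j (x 0 i * y 0 j) *: c (i, j)] : {ffun V -> V})].
have tE c x y : table_mul (t c) x y = \sum_i \sum_j (x 0 i * y 0 j) *: c (i, j).
  by rewrite /table_mul !ffunE.
have t_inj : injective t.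
  move=> c c' eqt; apply/ffunP=> -[i j].
  have tij d : table_mul (t d) (delta_mx 0 i) (delta_mx 0 j) = d (i, j).
    rewrite tE (bigD1 i) //= (bigD1 j) //= !mxE !eqxx mulr1 scale1r.
    rewrite !big1 ?addr0 // => [k ki|k kj].
      by rewrite big1 // => l _; rewrite !mxE (negPf ki) andbF mul0r scale0r.
    by rewrite !mxE (negPf kj) andbF mulr0 scale0r.
  by rewrite -tij eqt tij.
have <- : #|[set: {ffun 'I_m * 'I_m -> V}]| = (q ^ (m * m ^ 2))%N.
  by rewrite cardsT card_ffun card_prod card_mx card_ord mul1n -expnM mulnn.
rewrite -(card_imset _ t_inj); apply/subset_leq_card/subsetP => _ /imsetP[c _ ->].
apply/in_algebras; split=> //; split=> u a x y /=; rewrite !tE scaler_sumr -big_split;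
  apply: eq_bigr => i _; rewrite scaler_sumr -big_split; apply: eq_bigr => j _ /=;
  by rewrite !mxE scalerA -scalerDl ?(mulrDl, mulrDr) ?mulrA // (mulrC a).
Qed.

Definition preserving (S : {set V}) : {set mul_table F m} :=
  [set A in algebras (fun=> True) |
    [forall x in S, forall y in S, table_mul A x y \in S]].

Lemma preservingP S A :
  A \in preserving S <-> is_algebra (table_mul A) /\
    forall x y, x \in S -> y \in S -> table_mul A x y \in S.
Proof.
rewrite inE; split=> [/andP[/in_algebras[algA _] /forall_inP SA]|[algA SA]].
  by split=> // x y xS; have /forall_inP := SA x xS; apply.
apply/andP; split; first exact/in_algebras.
by apply/forall_inP=> x xS; apply/forall_inP=> y yS; apply: SA.
Qed.

(** In a basis that starts with a basis of [U], the products of two vectors of [U] must lie in [U],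
    while each of the others has [q ^ m] possible values. *)
Lemma card_preserving (U : {vspace V}) :
  (#|preserving [set x in U]| <=
     q ^ (\dim U * \dim U ^ 2 + m * (m ^ 2 - \dim U ^ 2)))%N.
Proof.
set d := \dim U.
have led : (d <= m)%N by rewrite -[X in (_ <= X)%N]dim_rV dimvS ?subvf.
have freeU : free (vbasis U) by apply: basis_free (vbasisP U).
have [b [bb bU]] := free_complete freeU.
have {}bU i : (i < d)%N -> b`_i \in U.
  by move=> ltid; rewrite bU ?size_tuple // vbasis_mem // mem_nth ?size_tuple.
pose I : {set 'I_m} := [set i : 'I_m | (i < d)%N].
have cI : #|I| = d.
  rewrite -[RHS]card_ord -(@card_imset _ _ (widen_ord led)); last first.
    by move=> i j /(congr1 (@nat_of_ord m))/= ij; apply: val_inj.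
  apply: eq_card => i; rewrite inE; apply/idP/imsetP => [ltid|[j _ ->]] /=.
    by exists (Ordinal ltid) => //; apply: val_inj.
  exact: ltn_ord.
pose D := setX I I.
apply: leq_trans (card_algebras_le (K := setT)
  (S := fun p => if p \in D then [set x in U] else setT) bb _ _ _) _.
- by apply/subsetP=> A; rewrite inE => /andP[].
- move=> A [i j] /preservingP[_ AU] _; case: ifP => [|_]; last by rewrite inE.
  rewrite in_setX => /andP[iI jI]; rewrite !inE in iI jI.
  by apply: AU; rewrite inE bU.
- by move=> A A' _ _ eqA i j; rewrite eqA // inE.
rewrite (bigID (mem D)) /=.
rewrite (eq_bigr (fun=> (q ^ d)%N)); last first.
  by move=> p /andP[_ ->]; rewrite cardsE card_vspace.
rewrite [X in (_ * X)%N](eq_bigr (fun=> (q ^ m)%N)); last first.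
  by move=> p /andP[_ /negPf ->]; rewrite cardsT card_mx mul1n.
rewrite !prod_nat_const.
rewrite (eq_card (B := mem D)) => [|p]; last by rewrite [LHS]unfold_in in_setT.
rewrite [X in (_ * _ ^ X)%N](eq_card (B := mem (~: D))) => [|p]; last first.
  by rewrite [LHS]unfold_in in_setT in_setC.
have -> : #|mem (~: D)| = (m ^ 2 - d ^ 2)%N.
  by rewrite -[LHS]/#|~: D| cardsCs setCK card_prod card_ord cardsX cI !mulnn.
by rewrite -[#|mem D|]/#|D| cardsX cI -!expnM -expnD mulnn.
Qed.

End Tables.

(** * Tables invariant under a matrix, and the action of GL *)

Section Fixed.
Variables (F : finFieldType) (n : nat).
Local Notation m := n.+1.
Local Notation V := 'rV[F]_m.
Local Notation q := #|F|.

(** Stability of the coordinate lines makes [g] diagonal; stability of the lines through [e_i + e_0]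
    makes the diagonal constant. *)
Lemma scalar_mx_of_lines (g : 'M[F]_m) :
  (forall x : V, x *m g \in <[x]>%VS) -> exists a, g = a%:M.
Proof.
move=> gl; have off i j : i != j -> g i j = 0.
  move=> nij; have /vlineP[k] := gl (delta_mx 0 i).
  rewrite -rowE => /rowP/(_ j); rewrite !mxE eqxx eq_sym (negPf nij) => ->.
  by rewrite mulr0.
exists (g 0 0); apply/matrixP=> i j; rewrite mxE.
have [<-|/off->] := eqVneq i j; last by rewrite mulr0n.
have [->|ni0] := eqVneq i 0; first by rewrite mulr1n.
rewrite mulr1n; have n0i : 0 != i by rewrite eq_sym.
have /vlineP[k] := gl (delta_mx 0 i + delta_mx 0 0).
rewrite mulmxDl -!rowE => /rowP gk.
have := gk i; have := gk 0; rewrite !mxE !eqxx (negPf ni0) (negPf n0i) /=.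
by rewrite (off _ _ ni0) (off _ _ n0i) !add0r !addr0 => -> ->.
Qed.

Definition fixed_tables (g : 'M[F]_m) : {set mul_table F m} :=
  [set A in algebras (fun=> True) |
    [forall x : V, forall y : V, table_mul A (x *m g) (y *m g) == table_mul A x y *m g]].

Lemma fixed_tablesP g A :
  A \in fixed_tables g <-> is_algebra (table_mul A) /\
    forall x y, table_mul A (x *m g) (y *m g) = table_mul A x y *m g.
Proof.
rewrite inE; split=> [/andP[/in_algebras[algA _] /forallP Ag]|[algA Ag]].
  by split=> // x y; apply/eqP; have /forallP := Ag x; apply.
apply/andP; split; first exact/in_algebras.
by apply/forallP=> x; apply/forallP=> y; apply/eqP.
Qed.

(** Invariance reads [a ^ 2 xy = a xy], which forces [xy = 0]. *)
Lemma card_fixed_tables_scalar (a : F) :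
  a != 0 -> a != 1 -> (#|fixed_tables a%:M| <= 1)%N.
Proof.
move=> a0 a1; have fix0 A x y : A \in fixed_tables a%:M -> table_mul A x y = 0.
  move=> /fixed_tablesP[[mulL mulR] /(_ x y)].
  have mulZl : table_mul A (a *: x) (a *: y) = a *: table_mul A x (a *: y).
    exact: (scalable_linear (mulL _)).
  have mulZr : table_mul A x (a *: y) = a *: table_mul A x y.
    exact: (scalable_linear (mulR _)).
  rewrite !mul_mx_scalar mulZl mulZr => /(scalerI a0)/eqP.
  rewrite -subr_eq0 -{2}[table_mul A x y]scale1r -scalerBl scaler_eq0 subr_eq0.
  by rewrite (negPf a1) => /eqP.
apply/card_le1_eqP=> A A' Ag A'g; apply: table_eqP => x y.
by rewrite !fix0.
Qed.

Lemma card_fixed_tables_nonscalar (g : 'M[F]_m) (x : V) :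
  g \in unitmx -> x *m g \notin <[x]>%VS ->
  (#|fixed_tables g| <= q ^ (m * (n ^ 2 + 2)))%N.
Proof.
move=> gU xg.
have free2 : free [:: x *m g; x].
  rewrite free_cons span_seq1 xg seq1_free; apply: contraNneq xg => ->.
  by rewrite mul0mx mem0v.
have n_gt0 : (0 < n)%N.
  have := dimvS (subvf <<[:: x *m g; x]>>%VS).
  by rewrite (eqnP free2) dim_rV.
have [b [bb b2]] := free_complete free2.
pose i1 : 'I_m := inord 1.
(* The dependent vector [x *m g] gets index 0 and [x] index 1. Then [K] omits every product
   involving index 0 except the two with [x]. *)
have b0 : b`_(0%R : 'I_m) = x *m g by rewrite b2.
have b1 : b`_i1 = x by rewrite /i1 inordK // b2.
have i1n0 : i1 != 0 by apply/eqP=> /(congr1 val); rewrite /= inordK.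
pose N : {set 'I_m} := [set~ 0].
pose K := setX N N :|: [set (0, i1); (i1, 0)].
have cK : (#|K| <= n ^ 2 + 2)%N.
  apply: leq_trans (leq_card_setU _ _) _; rewrite cardsX cardsC1 card_ord.
  by rewrite mulnn leq_add2l cards2; case: eqP.
apply: leq_trans (card_algebras_le (K := K) (S := fun=> setT) bb _ _ _) _.
- by apply/subsetP=> A; rewrite inE => /andP[].
- by move=> *; rewrite inE.
- move=> A A' /fixed_tablesP[algA Ag] /fixed_tablesP[algA' A'g] eqK.
  have eqN (i j : 'I_m) : i != 0 -> j != 0 ->
      table_mul A b`_i b`_j = table_mul A' b`_i b`_j.
    by move=> i0 j0; apply: eqK; rewrite in_setU in_setX !inE i0 j0.
  have eqr : forall v, table_mul A x v = table_mul A' x v.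
    apply: (eq_mulr_basis algA algA' bb) => j; rewrite -b1.
    have [->|] := eqVneq j 0; last exact: eqN.
    by apply: eqK; rewrite in_setU in_set2 eqxx !orbT.
  have eql : forall v, table_mul A v x = table_mul A' v x.
    apply: (eq_mull_basis algA algA' bb) => j; rewrite -b1.
    have [->|] := eqVneq j 0; last by move=> ?; exact: eqN.
    by apply: eqK; rewrite in_setU in_set2 eqxx !orbT.
  move=> i j; have [->|i0] := eqVneq i 0.
    (* Writing [b_j] as [w *m g] turns the product of [x *m g] and [b_j] into the image under [g] of
       the product of [x] and [w]. *)
    by rewrite b0 -[b`_j](mulmxKV gU) Ag A'g eqr.
  have [->|j0] := eqVneq j 0; last exact: eqN.
  by rewrite b0 -[b`_i](mulmxKV gU) Ag A'g eql.
rewrite prod_nat_const cardsT card_mx mul1n -expnM leq_exp2l ?leq_mul2l ?cK ?orbT //.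
exact: finNzRing_gt1.
Qed.

Lemma card_fixed_tables (g : 'M[F]_m) : g \in unitmx -> g != 1%:M ->
  (#|fixed_tables g| <= q ^ (m * (n ^ 2 + 2)))%N.
Proof.
move=> gU g1.
have [gl|] := pselect (forall x : V, x *m g \in <[x]>%VS); last first.
  by move/existsNP=> [x /negP]; apply: card_fixed_tables_nonscalar.
have [a ga] := scalar_mx_of_lines gl; rewrite ga in gU g1 *.
apply: leq_trans (card_fixed_tables_scalar _ _) _; last by rewrite expn_gt0 (cardD1 0) inE.
  apply: contraTneq gU => ->; by rewrite raddf0 (unitr0 'M[F]_m).
by apply: contraNneq g1 => ->.
Qed.

Implicit Types (A : mul_table F m) (P : (V -> V -> V) -> Prop).

(** Transport of structure: right multiplication by [g] is an isomorphism from [A] onto the new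
    table. Row vectors make this a right action. *)
Definition table_act A (g : {'GL_m[F]}) : mul_table F m :=
  [ffun x : V => ([ffun y : V =>
     table_mul A (x *m GLval (g^-1)%g) (y *m GLval (g^-1)%g) *m GLval g] : {ffun V -> V})].

Lemma table_actE A g x y : table_mul (table_act A g) x y =
  table_mul A (x *m GLval (g^-1)%g) (y *m GLval (g^-1)%g) *m GLval g.
Proof. by rewrite /table_mul !ffunE. Qed.

Lemma table_act1 : table_act^~ 1%g =1 id.
Proof.
by move=> A; apply: table_eqP => x y; rewrite table_actE invg1 GL_1E !mulmx1.
Qed.

Lemma table_actM A : act_morph table_act A.
Proof.
move=> g h; apply: table_eqP => x y.
by rewrite !table_actE invMg !GL_MxE !mulmxA.
Qed.

Canonical table_action := TotalAction table_act1 table_actM.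

Local Notation G := [set: {'GL_m[F]}].

Lemma GL_mulmxK (g : {'GL_m[F]}) (x : V) :
  x *m GLval g *m GLval (g^-1)%g = x.
Proof. by rewrite -mulmxA -[_ *m GLval _]/(GLval (g * g^-1)%g) mulgV mulmx1. Qed.

Lemma GL_mulmxKV (g : {'GL_m[F]}) (x : V) :
  x *m GLval (g^-1)%g *m GLval g = x.
Proof. by rewrite -mulmxA -[_ *m GLval g]/(GLval (g^-1 * g)%g) mulVg mulmx1. Qed.

(** A linear bijection of row vectors is right multiplication by an invertible matrix, so
    isomorphisms between tables are exactly group elements carrying one to the other. *)
Lemma orbit_table_iso A B :
  (B \in orbit table_action G A) =
  `[< algebra_iso (table_mul A) (table_mul B) >].
Proof.
apply/orbitP/asboolP => [[g _ <-]|[f [[f' fK f'K] fM]]].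
  exists (mulmxr (GLval g)); split=> [|x y] /=.
    by exists (mulmxr (GLval (g^-1)%g)); [exact: GL_mulmxK | exact: GL_mulmxKV].
  by rewrite table_actE !GL_mulmxK.
have fU : lin1_mx f \in unitmx.
  rewrite -row_free_unit; apply: inj_row_free => v.
  by rewrite mul_rV_lin1 -[RHS](raddf0 f) => /(can_inj fK).
pose g : {'GL_m[F]} := FinRing.Unit (fU : lin1_mx f \is a GRing.unit).
exists g => //; apply: table_eqP => x y; rewrite table_actE.
have gV z : f (z *m GLval (g^-1)%g) = z.
  by rewrite -mul_rV_lin1 mulmxKV.
by rewrite mul_rV_lin1 fM !gV.
Qed.

End Fixed.

(** * Invariance of the algebra properties under isomorphism *)

Section Invariance.
Variables (F : fieldType) (V W : vectType F).
Variables (mulV : V -> V -> V) (mulW : W -> W -> W).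

Lemma is_algebra_iso : algebra_iso mulV mulW -> is_algebra mulV -> is_algebra mulW.
Proof.
move=> iVW [mulVl mulVr]; have [f [[f' fK f'K] fM]] := iVW.
split=> u a x y; rewrite -(f'K u) -(f'K x) -(f'K y) -linearP -!fM.
  by rewrite mulVl linearP.
by rewrite mulVr linearP.
Qed.

Lemma subalgebra_lpreim (f : {linear V -> W}) (U : {vspace W}) :
  (forall x y, f (mulV x y) = mulW (f x) (f y)) ->
  subalgebra mulW U -> subalgebra mulV (linfun f @^-1: U)%VS.
Proof.
move=> fM sU x y; rewrite -!memv_preim !lfunE /= fM.
exact: sU.
Qed.

Lemma cyclic_algebra_iso :
  algebra_iso mulV mulW -> cyclic_algebra mulV -> cyclic_algebra mulW.
Proof.
case=> f [[f' fK f'K] fM] [a gen_a]; exists (f a) => x U sU fa.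
have := gen_a (f' x) _ (subalgebra_lpreim fM sU).
by rewrite -!memv_preim !lfunE /= f'K; apply.
Qed.

Lemma no_proper_subalgebra_iso : algebra_iso mulV mulW ->
  no_proper_subalgebra_dim_gt1 mulV -> no_proper_subalgebra_dim_gt1 mulW.
Proof.
case=> f [[f' fK f'K] fM] noV U sU nU.
have imf : limg (linfun f) = fullv.
  apply/vspaceP=> y; rewrite memvf; apply/memv_imgP; exists (f' y).
    exact: memvf.
  by rewrite lfunE /= f'K.
(* Since [U] is the image of its preimage, the dimension of [U] is at most that of the preimage, to
   which the hypothesis on [V] applies. *)
have U_img : (linfun f @: (linfun f @^-1: U))%VS = U.
  by rewrite lpreimK // imf subvf.
have := noV _ (subalgebra_lpreim fM sU).
rewrite -!leqNgt => noU.
apply: leq_trans (noU _); first by rewrite -{1}U_img -(limg_ker_dim (linfun f)) leq_addl.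
by apply: contraNneq nU => Uf; rewrite -U_img Uf imf.
Qed.

End Invariance.

(** * Burnside's formula and the comparison of [phi] with [phiP] *)

Section Burnside.
Variables (F : finFieldType) (n : nat).
Local Notation m := n.+1.
Local Notation V := 'rV[F]_m.
Local Notation q := #|F|.
Local Notation G := [set: {'GL_m[F]}].
Implicit Types (P : (V -> V -> V) -> Prop).

Definition iso_invariant P := forall mul mul', algebra_iso mul mul' -> P mul -> P mul'.

Lemma algebras_iso P (A B : mul_table F m) : iso_invariant P ->
  algebra_iso (table_mul A) (table_mul B) -> A \in algebras P -> B \in algebras P.
Proof.
move=> isoP AB /in_algebras[algA PA]; apply/in_algebras.
by split; [exact: is_algebra_iso algA | exact: isoP PA].
Qed.

Lemma num_iso_classes_Burnside P : iso_invariant P ->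
  (num_iso_classes P * #|G| =
     \sum_(g in G) #|('Fix_(algebras P | table_action F n)[g])%g|)%N.
Proof.
move=> isoP; rewrite Frobenius_Cauchy; last first.
  apply/actsP=> g _ A.
  have iA : algebra_iso (table_mul A) (table_mul (table_action F n A g)).
    by apply/asboolP; rewrite -orbit_table_iso; apply: mem_orbit; rewrite inE.
  by apply/idP/idP; apply: algebras_iso isoP _; first exact: algebra_iso_sym.
(* Classes are cut out inside [algebras P], orbits inside all tables; they agree because [P] is
   isomorphism invariant. *)
congr (#|pred_of_set _| * _)%N; apply: eq_in_imset => A AP.
apply/setP=> B; rewrite inE -orbit_table_iso; apply: andb_idl.
by rewrite orbit_table_iso => /asboolP/algebras_iso; apply.
Qed.

Lemma fix_table_action P (g : {'GL_m[F]}) :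
  ('Fix_(algebras P | table_action F n)[g])%g \subset fixed_tables (GLval g).
Proof.
apply/subsetP=> A /setIP[/in_algebras[algA _] /afix1P Ag]; apply/fixed_tablesP.
by split=> // x y; rewrite -{1}Ag table_actE !GL_mulmxK.
Qed.

Lemma card_GL_le : (#|G| <= q ^ m ^ 2)%N.
Proof.
rewrite cardsT -mulnn -(card_mx F m m).
exact: (leq_card _ (val_inj : injective (@GLval m F))).
Qed.

(** The identity alone contributes all algebras to the Burnside sum. *)
Lemma phi_ge : (q ^ (m * m ^ 2) <= phi F m * #|G|)%N.
Proof.
apply: leq_trans (card_algebras_ge F m) _.
rewrite num_iso_classes_Burnside // (bigD1 1%g) ?inE //=.
apply: leq_trans (leq_addr _ _).
by rewrite afix1 setIT.
Qed.

Definition generic (mul : V -> V -> V) :=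
  cyclic_algebra mul /\ no_proper_subalgebra_dim_gt1 mul.

Lemma iso_invariant_generic : iso_invariant generic.
Proof.
move=> mul mul' i [cyc nop].
by split; [exact: cyclic_algebra_iso cyc | exact: no_proper_subalgebra_iso nop].
Qed.

Lemma algebrasS P : algebras P \subset algebras (F := F) (m := m) (fun=> True).
Proof. by apply/subsetP=> A /in_algebras[? _]; apply/in_algebras. Qed.

Lemma phiP_le_phi : (phiP F m <= phi F m)%N.
Proof.
have G_gt0 : (0 < #|G|)%N := cardG_gt0 _.
rewrite -(leq_pmul2r G_gt0).
rewrite [leqLHS](num_iso_classes_Burnside iso_invariant_generic).
rewrite [leqRHS]num_iso_classes_Burnside //; apply: leq_sum => g _.
by apply: subset_leq_card; rewrite setSI // algebrasS.
Qed.

(** Compare the two Burnside sums: the identity terms differ by the non-generic tables, and the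
    remaining terms for [phi] are at most [q ^ m ^ 2] in number, each bounded by
    [card_fixed_tables]. *)
Lemma phi_subn_phiP_le : ((phi F m - phiP F m) * #|G| <=
  #|algebras (fun=> True) :\: algebras generic| + q ^ (m ^ 2 + m * (n ^ 2 + 2)))%N.
Proof.
rewrite mulnBl leq_subLR addnA.
rewrite [leqLHS]num_iso_classes_Burnside //.
rewrite [X in (X + _ + _)%N](num_iso_classes_Burnside iso_invariant_generic).
rewrite (bigD1 1%g) ?inE //= [X in (X + _ + _)%N](bigD1 1%g) ?inE //=.
rewrite afix1 !setIT.
apply: leq_add.
  apply: (@leq_trans (#|algebras generic| + #|algebras (fun=> True) :\: algebras generic|)).
    rewrite -(cardsID (algebras generic) (algebras (fun=> True))) leq_add2r.
    by rewrite subset_leq_card // subsetIr.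
  by rewrite leq_add2r leq_addr.
rewrite expnD; apply: leq_trans (leq_mul card_GL_le (leqnn _)).
rewrite -sum_nat_const big_mkcond [leqRHS]big_mkcond; apply: leq_sum => g _.
case: ifP => [/andP[-> g1]|] //=.
apply: leq_trans (subset_leq_card (fix_table_action _ _)) _.
apply: card_fixed_tables; first exact: (GL_unit g).
by apply: contraNneq g1 => g1; apply/eqP/val_inj.
Qed.

End Burnside.

(** * Union bound for non-generic tables *)

Lemma card_bigcup_le (T I : finType) (P : pred I) (S : I -> {set T}) (c : nat) :
  (forall i, P i -> #|S i| <= c)%N -> (#|\bigcup_(i | P i) S i| <= #|I| * c)%N.
Proof.
move=> Sc; apply: (@leq_trans (\sum_(i | P i) c)); last first.
  by rewrite sum_nat_const leq_mul2r max_card orbT.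
elim/big_rec2: _ => [|i k X Pi le_X]; first by rewrite cards0.
by apply: leq_trans (leq_card_setU _ _) _; apply: leq_add; first exact: Sc.
Qed.

(** With [m = n + 1] the claim is [md - d^2 (m - d) <= -n]. At [d = 2] it reads [6 - 2n <= -n],
    whence the bound 6; it fails at [d = n], so hyperplanes are counted separately. *)
Lemma exponent_le n d : (6 <= n)%N -> (2 <= d < n)%N ->
  (n.+1 * d + (d * d ^ 2 + n.+1 * (n.+1 ^ 2 - d ^ 2)) <= n.+1 * n.+1 ^ 2 - n)%N.
Proof.
move=> n6 /andP[d2 ltdn].
(* This substitution absorbs the bounds on [d]; [3 <= e + k] is what remains of [6 <= n]. *)
have [e [k [-> -> ek]]] : exists e k, [/\ d = e + 2, n = e + k + 3 & 3 <= e + k]%N.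
  by exists (d - 2)%N, (n - d - 1)%N; split; lia.
by rewrite !expnS !expn0; nia.
Qed.

Section NonGeneric.
Variables (F : finFieldType) (n : nat).
Local Notation m := n.+1.
Local Notation V := 'rV[F]_m.
Local Notation q := #|F|.

Lemma expn_card_le a b : (a <= b)%N -> (q ^ a <= q ^ b)%N.
Proof. by move=> leab; rewrite leq_exp2l // finNzRing_gt1. Qed.

(** Indexing by linear forms gives only [q ^ m] candidates; the form 0 yields the full space, which
    a dimension condition excludes later. *)
Definition hyperplane (c : 'cV[F]_m) : {vspace V} := lker (linfun (mulmxr c)).

(** Complete a basis of [U] by one vector; [U] is the kernel of the last coordinate. *)
Lemma hyperplaneP (U : {vspace V}) :
  \dim U = n -> exists c, U = hyperplane c.
Proof.
move=> dimU; have freeU : free (vbasis U) by apply: basis_free (vbasisP U).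
have [b [bb bU]] := free_complete freeU.
rewrite size_tuple in bU.
pose c : 'cV[F]_m := \col_i coord b ord_max (delta_mx 0 i).
have cE (x : V) : x *m c = (coord b ord_max x)%:M.
  apply/rowP=> k; rewrite (ord1 k) [RHS]mxE mulr1n {2}[x]row_sum_delta linear_sum mxE.
  by apply: eq_bigr => i _; rewrite linearZ mxE.
exists c; apply/eqP; rewrite eqEdim; apply/andP; split.
  rewrite -(span_basis (vbasisP U)); apply/span_subvP=> x /(nthP 0)[i].
  rewrite size_tuple => ltiU <-; rewrite memv_ker lfunE /= cE -bU //.
  rewrite dimU in ltiU; pose i' : 'I_m := Ordinal (leqW ltiU).
  have -> : coord b ord_max b`_i = (i' == ord_max)%:R.
    exact: (coord_free i' ord_max (basis_free bb)).
  suff /negPf-> : i' != ord_max by rewrite raddf0.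
  by apply/eqP=> /(congr1 val) /= i_n; have := ltiU; rewrite i_n ltnn.
rewrite dimU -ltnS ltnNge; apply/negP => le_c.
have c_full : hyperplane c = fullv by apply/eqP; rewrite eqEdim subvf dim_rV.
have : b`_(@ord_max n) \in hyperplane c by rewrite c_full memvf.
rewrite memv_ker lfunE /= cE.
rewrite (coord_free ord_max ord_max (basis_free bb)) eqxx.
by move/eqP/matrixP/(_ 0 0)/eqP; rewrite !mxE eqxx oner_eq0.
Qed.

Lemma card_nongeneric_le : (6 <= n)%N ->
  (#|algebras (fun=> True) :\: algebras (@generic F n)| <=
     n * q ^ (m * m ^ 2 - n))%N.
Proof.
move=> n6; set N := (q ^ _)%N.
pose e0 : V := delta_mx 0 0.
have e0n : e0 != 0.
  by apply/eqP=> /rowP/(_ 0)/eqP; rewrite !mxE !eqxx oner_eq0.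
pose X1 := preserving [set x in <[e0]>%VS].
(* The index is the dimension minus 2, so dimensions 2 to [n - 1] are covered. Enumerating subspaces
   by spanning tuples overcounts, which the union bound tolerates. *)
pose X2 := \bigcup_(d : 'I_(n - 2)) \bigcup_(b : d.+2.-tuple V | \dim <<b>> == d.+2)
  preserving [set x in <<b>>%VS].
pose X3 := \bigcup_(c : 'cV[F]_m | \dim (hyperplane c) == n)
  preserving [set x in hyperplane c].
have cX1 : (#|X1| <= N)%N.
  apply: leq_trans (card_preserving _) _; rewrite dim_vline e0n.
  by apply: expn_card_le; rewrite /= !expnS !expn0; nia.
have cX2 : (#|X2| <= (n - 2) * N)%N.
  rewrite -[X in (X * _)%N](card_ord (n - 2)); apply: card_bigcup_le => d _.
  have ltd := ltn_ord d.
  apply: leq_trans (card_bigcup_le (c := q ^ (d.+2 * d.+2 ^ 2 + m * (m ^ 2 - d.+2 ^ 2))) _) _.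
    by move=> b /eqP dim_b; apply: leq_trans (card_preserving _) _; rewrite dim_b.
  rewrite card_tuple card_mx mul1n -expnM -expnD; apply: expn_card_le.
  by rewrite exponent_le //; lia.
have cX3 : (#|X3| <= N)%N.
  apply: leq_trans (card_bigcup_le (c := q ^ (n * n ^ 2 + m * (m ^ 2 - n ^ 2))) _) _.
    by move=> b /eqP dim_b; apply: leq_trans (card_preserving _) _; rewrite dim_b.
  rewrite card_mx muln1 -expnD; apply: expn_card_le.
  by rewrite !expnS !expn0; nia.
apply: (@leq_trans #|X1 :|: X2 :|: X3|); last first.
  apply: leq_trans (leq_card_setU _ _) _.
  apply: leq_trans (leq_add (leq_card_setU _ _) cX3) _.
  have : (#|X1| + #|X2| + N <= N + (n - 2) * N + N)%N.
    by rewrite leq_add2r leq_add.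
  by move/leq_trans; apply; nia.
apply/subset_leq_card/subsetP => A /setDP[/in_algebras[algA _] Agen].
have preserve (U : {vspace V}) :
    subalgebra (table_mul A) U -> A \in preserving [set x in U].
  by move=> sU; apply/preservingP; split=> // x y; rewrite !inE; apply: sU.
have small U : subalgebra (table_mul A) U -> U != fullv -> (1 < \dim U)%N -> 
  A \in X2 :|: X3.
  move=> sU nU U1.
  have Um : (\dim U < m)%N.
    rewrite ltnNge; apply: contra nU => leU.
    by rewrite eqEdim subvf dim_rV.
  have [Un|Un] := ltnP (\dim U) n; last first.
    have {Un} dimU : \dim U = n by apply/eqP; rewrite eqn_leq Un andbT.
    have [c Uc] := hyperplaneP dimU.
    rewrite inE; apply/orP; right; apply/bigcupP; exists c; first by rewrite -Uc dimU.
    by apply: preserve; rewrite -Uc.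
  rewrite inE; apply/orP; left.
  have ltd : (\dim U - 2 < n - 2)%N by lia.
  apply/bigcupP; exists (Ordinal ltd) => //=.
  have dU : \dim U = (\dim U - 2).+2 by lia.
  apply/bigcupP; exists (tcast dU (vbasis U)).
    by rewrite val_tcast (span_basis (vbasisP U)) {1}dU.
  by apply: preserve; rewrite val_tcast (span_basis (vbasisP U)).
apply: contraR Agen; rewrite -setUA in_setU negb_or => /andP[A1 A23].
apply/in_algebras; split=> //.
have nop : no_proper_subalgebra_dim_gt1 (table_mul A).
  by move=> U sU nU; apply: contraNN A23; apply: small.
split=> //; exists e0 => x U sU eU.
have -> : U = fullv; last exact: memvf.
(* A proper subalgebra containing [e0] has dimension at most 1, hence is the line of [e0], which
   [A1] forbids. *)
apply/eqP; apply: contraNT A1 => nU; have := nop U sU nU.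
rewrite -leqNgt => U1; apply: preserve.
suff -> : <[e0]>%VS = U by [].
by apply/eqP; rewrite eqEdim -memvE eU (leq_trans U1) // dim_vline e0n.
Qed.

(** Non-generic tables contribute [n] times [q ^ (m ^ 3 - n)], and the non-identity group elements
    at most once more. By [phi_ge] the order of the group cancels. *)
Lemma phiP_defect : (6 <= n)%N ->
  ((phi F m - phiP F m) * q ^ n <= m * phi F m)%N.
Proof.
move=> n6; have G_gt0 : (0 < #|[set: {'GL_m[F]}]|)%N := cardG_gt0 _.
have le_defect : ((phi F m - phiP F m) * #|[set: {'GL_m[F]}]| <=
    m * q ^ (m * m ^ 2 - n))%N.
  apply: leq_trans (phi_subn_phiP_le F n) _; rewrite mulSn addnC.
  apply: leq_add (card_nongeneric_le n6); apply: expn_card_le.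
  by rewrite !expnS !expn0; nia.
rewrite -(leq_pmul2r G_gt0) mulnAC; apply: leq_trans (leq_mul le_defect (leqnn _)) _.
rewrite -mulnA -expnD subnK; last by rewrite !expnS; nia.
by rewrite -mulnA leq_mul2l phi_ge orbT.
Qed.

End NonGeneric.

(* Passage to the limit *)
From mathcomp Require Import all_classical all_reals all_analysis.

Import GRing.Theory Num.Theory numFieldNormedType.Exports.
Local Open Scope classical_set_scope.
Local Open Scope ring_scope.

Lemma sqr_le_expn2 (n : nat) : (4 <= n)%N -> (n ^ 2 <= 2 ^ n)%N.
Proof.
elim: n => // n IHn; rewrite leq_eqVlt => /orP[/eqP <- //|lt4n].
have := IHn lt4n; rewrite !expnS !expn0; nia.
Qed.

(** With [m = n + 1], the relative defect is at most [m / q ^ n], and [m ^ 2 <= 2 ^ m <= 2 q ^ n]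
    makes this at most [2 / m], where [harmonic n] is [1 / m]. *)
Lemma phi_ratio_ge (R : realType) (F : finFieldType) (n : nat) : (6 <= n)%N ->
  1 - 2 * harmonic n <= (phiP F n.+1)%:R / (phi F n.+1)%:R :> R.
Proof.
move=> n6; have phi_gt0 : (0 < phi F n.+1)%N.
  have : (0 < #|F| ^ (n.+1 * n.+1 ^ 2))%N by rewrite expn_gt0 (cardD1 0) inE.
  by move=> /leq_trans/(_ (phi_ge F n)); rewrite muln_gt0 => /andP[].
have q2 : (2 ^ n <= #|F| ^ n)%N.
  rewrite leq_exp2r; first exact: finNzRing_gt1.
  by apply: leq_trans n6.
have defect : ((phi F n.+1 - phiP F n.+1) * n.+1 <= 2 * phi F n.+1)%N.
  have le_q : (n.+1 * n.+1 <= 2 * #|F| ^ n)%N.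
    rewrite mulnn; apply: leq_trans (sqr_le_expn2 _) _; first by lia.
    by rewrite expnS leq_mul2l q2.
  rewrite -(leq_pmul2r (ltn0Sn n)) -mulnA.
  apply: leq_trans (leq_mul (leqnn _) le_q) _.
  rewrite mulnCA -mulnA leq_mul2l /= [leqRHS]mulnC.
  exact: phiP_defect.
rewrite ler_pdivlMr ?ltr0n // mulrBl mul1r lerBlDr -lerBlDl.
rewrite -natrB ?phiP_le_phi // /harmonic mulrAC ler_pdivlMr ?ltr0n //.
by rewrite -!natrM ler_nat.
Qed.

Theorem theorem23 (R : realType) (F : finFieldType) :
  (fun m : nat => (phiP F m)%:R / (phi F m)%:R : R) @ \oo --> (1 : R).
Proof.
(* The estimates concern dimension [n.+1], so the sequence is shifted by one. *)
rewrite -cvg_shiftS.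
apply: (@squeeze_cvgr _ _ _ _ (fun n => 1 - 2 * harmonic n) (fun=> 1)).
- exists 6%N => // n /= n6; rewrite phi_ratio_ge //=.
  (* Division by zero yields 0, so the upper bound 1 also holds in that case. *)
  have [->|] := posnP (phi F n.+1); first by rewrite invr0 mulr0.
  by move=> phi_gt0; rewrite ler_pdivrMr ?ltr0n // mul1r ler_nat phiP_le_phi.
- rewrite -[X in _ --> X]subr0 -[X in _ - X](mulr0 2).
  by apply: cvgB; [exact: cvg_cst | apply: cvgM; [exact: cvg_cst | exact: cvg_harmonic]].
- exact: cvg_cst.
Qed.
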